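(* For every $n\ge3$, $$\chi(\overline{\mathcal M}_{0,n})=n!\cdot\Big[\sum_{k=0}^{n-3}A_k(x)\Big]_n,$$ where $[\cdot]_n$ denotes the coefficient of $x^n$, and the power series $A_k(x)$ are given by $$A_0=\frac12(1+x)^2\log(1+x)-\frac12x-\frac34x^2,$$ $$A_1=\frac12+(1+x)(\log(1+x)-1)+\frac12(1+x)^2(\log(1+x)-1)^2,$$ and for $k\ge2$, $$A_k=\sum_{m=-2}^{k-2}\frac{(x+1)^{-m}}{(m+2)!}\sum_{l=0}^{k-m-1}\frac{(\log(x+1)-1)^l}{l!}\,e_{l+m}(1-m,2-m,\dots,k-m-1),$$ where $e_l(x_1,\dots,x_N)=\sum_{1\le j_1<\cdots<j_l\le N}x_{j_1}\cdots x_{j_l}$ for $l\ge0$ are the elementary symmetric polynomials and $e_l:=0$ for $l<0$.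
   Context: $\chi(\overline{\mathcal M}_{g,n})$ is the orbifold Euler characteristic of the Deligne–Mumford moduli space of stable genus $g$ curves with $n$ marked points. By Bini–Harer, $\chi(\overline{\mathcal M}_{g,n})=n!\sum_{\Gamma}\frac1{|\mathrm{Aut}(\Gamma)|}\prod_v\chi(\mathcal M_{g_v,\mathrm{val}_v})$, the sum being over isomorphism classes of connected stable graphs of genus $g$ with $n$ unlabelled external edges (vertices $v$ have genus $g_v$ and valence $\mathrm{val}_v$ with $2g_v-2+\mathrm{val}_v>0$; the genus of $\Gamma$ is $h^1(\Gamma)+\sum_vg_v$; automorphisms act on vertices and half-edges and may permute external edges), and by Harer–Zagier $\chi(\mathcal M_{g,n})=(-1)^n\frac{(2g-1)B_{2g}}{(2g)!}(2g+n-3)!$. The argument list $1-m,2-m,\dots,k-m-1$ consists of the $k-1$ consecutive integers from $1-m$ to $k-m-1$, and $e_l$ of a list with fewer than $l$ entries is $0$. *)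

(* Defs.v *)
From HB Require Import structures.
From mathcomp Require Import all_boot all_order all_fingroup all_algebra.
From mathcomp Require Import boolp classical_sets fsbigop.

Set Implicit Arguments.
Unset Strict Implicit.
Unset Printing Implicit Defensive.

Import Order.TTheory GRing.Theory Num.Theory.
Local Open Scope ring_scope.

Record fps (F : fieldType) := Fps { fps_coef :> nat -> F }.

HB.instance Definition _ (F : fieldType) := gen_eqMixin (fps F).
HB.instance Definition _ (F : fieldType) := gen_choiceMixin (fps F).

Section FpsRing.

Variable F : fieldType.
Implicit Types (a b : F) (f g h : fps F).

Lemma fpsP f g : (forall n, f n = g n) <-> f = g.
Proof.
split=> [eq_fg | -> //]; case: f g eq_fg => [f] [g] /= eq_fg.
by congr Fps; apply/funext.
Qed.

Definition fps_zero : fps F := Fps (fun=> 0).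
Definition fps_opp f : fps F := Fps (fun n => - f n).
Definition fps_add f g : fps F := Fps (fun n => f n + g n).
Definition fps_one : fps F := Fps (fun n => (n == 0%N)%:R).
Definition fps_mul f g : fps F :=
  Fps (fun n => \sum_(i < n.+1) f i * g (n - i)%N).
Definition fps_scale a f : fps F := Fps (fun n => a * f n).

Let fps_addA : associative fps_add.
Proof. by move=> f g h; apply/fpsP => n /=; rewrite addrA. Qed.
Let fps_addC : commutative fps_add.
Proof. by move=> f g; apply/fpsP => n /=; rewrite addrC. Qed.
Let fps_add0 : left_id fps_zero fps_add.
Proof. by move=> f; apply/fpsP => n /=; rewrite add0r. Qed.
Let fps_addN : left_inverse fps_zero fps_opp fps_add.
Proof. by move=> f; apply/fpsP => n /=; rewrite addNr. Qed.

HB.instance Definition _ :=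
  GRing.isZmodule.Build (fps F) fps_addA fps_addC fps_add0 fps_addN.

Let trunc n f : {poly F} := \poly_(i < n.+1) f i.

Let coef_trunc n f i : (i <= n)%N -> (trunc n f)`_i = f i.
Proof. by move=> le_in; rewrite coef_poly ltnS le_in. Qed.

Let fps_mul_trunc m n f g : (n <= m)%N ->
  fps_mul f g n = (trunc m f * trunc m g)`_n.
Proof.
move=> le_nm; rewrite coefM; apply: eq_bigr => -[i /= lt_in] _.
by rewrite !coef_trunc // ?(leq_trans _ le_nm) ?leq_subr.
Qed.

Let fps_mulA : associative fps_mul.
Proof.
move=> f g h; apply/fpsP => n.
transitivity ((trunc n f * (trunc n g * trunc n h))`_n).
  rewrite coefM; apply: eq_bigr => -[i /= lt_in] _.
  by rewrite coef_trunc // -(@fps_mul_trunc n) // leq_subr.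
rewrite mulrA coefM; apply: eq_bigr => -[i /= lt_in] _.
by rewrite -(@fps_mul_trunc n) // coef_trunc // leq_subr.
Qed.

Let fps_mulC : commutative fps_mul.
Proof.
by move=> f g; apply/fpsP => n; rewrite !(@fps_mul_trunc n) // mulrC.
Qed.

Let fps_mul1 : left_id fps_one fps_mul.
Proof.
move=> f; apply/fpsP => n /=; rewrite big_ord_recl /= mul1r subn0.
by rewrite big1 ?addr0 // => i _; rewrite mul0r.
Qed.

Let fps_mulDl : left_distributive fps_mul fps_add.
Proof.
move=> f g h; apply/fpsP => n /=; rewrite -big_split /=.
by apply: eq_bigr => i _; rewrite mulrDl.
Qed.

Let fps_oner_neq0 : fps_one != fps_zero.
Proof.
by apply/eqP => /fpsP /(_ 0%N) /= /eqP; rewrite (negPf (oner_neq0 F)).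
Qed.

HB.instance Definition _ := GRing.Zmodule_isComNzRing.Build (fps F)
  fps_mulA fps_mulC fps_mul1 fps_mulDl fps_oner_neq0.

Let fps_scaleA a b f : fps_scale a (fps_scale b f) = fps_scale (a * b) f.
Proof. by apply/fpsP => n /=; rewrite mulrA. Qed.
Let fps_scale1 : left_id 1 fps_scale.
Proof. by move=> f; apply/fpsP => n /=; rewrite mul1r. Qed.
Let fps_scaleDr : right_distributive fps_scale +%R.
Proof. by move=> a f g; apply/fpsP => n /=; rewrite mulrDr. Qed.
Let fps_scaleDl f : {morph fps_scale^~ f : a b / a + b}.
Proof. by move=> a b; apply/fpsP => n /=; rewrite mulrDl. Qed.

HB.instance Definition _ := GRing.Zmodule_isLmodule.Build F (fps F)
  fps_scaleA fps_scale1 fps_scaleDr fps_scaleDl.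

Let fps_scaleAl a f g : a *: (f * g) = (a *: f) * g.
Proof.
apply/fpsP => n; rewrite [LHS]mulr_sumr.
by apply: eq_bigr => i _; rewrite /= mulrA.
Qed.

HB.instance Definition _ :=
  GRing.Lmodule_isLalgebra.Build F (fps F) fps_scaleAl.
HB.instance Definition _ := GRing.Lalgebra_isComAlgebra.Build F (fps F).

Lemma coef_fps0 n : (0 : fps F) n = 0. Proof. by []. Qed.
Lemma coef_fps1 n : (1 : fps F) n = (n == 0%N)%:R. Proof. by []. Qed.
Lemma coef_fpsN f n : (- f) n = - f n. Proof. by []. Qed.
Lemma coef_fpsD f g n : (f + g) n = f n + g n. Proof. by []. Qed.
Lemma coef_fpsZ a f n : (a *: f) n = a * f n. Proof. by []. Qed.
Lemma coef_fpsM f g n : (f * g) n = \sum_(i < n.+1) f i * g (n - i)%N.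
Proof. by []. Qed.

(* The coefficients g_0, ..., g_n of the g such that f * g = 1, by
   f_0 g_n = - \sum_(i < n) f_(i+1) g_(n-i-1). *)
Fixpoint fps_inv_coefs f n : seq F :=
  if n is p.+1 then
    let s := fps_inv_coefs f p in
    rcons s (- ((f 0%N)^-1 * \sum_(i < n) f i.+1 * s`_(p - i)))
  else [:: (f 0%N)^-1].

Definition fps_unit : pred (fps F) := fun f => f 0%N != 0.
Definition fps_inv f : fps F :=
  if f 0%N == 0 then f else Fps (fun n => (fps_inv_coefs f n)`_n).

Let size_fps_inv_coefs f n : size (fps_inv_coefs f n) = n.+1.
Proof. by elim: n => //= n IHn; rewrite size_rcons IHn. Qed.

Let nth_fps_inv_coefs f m n : (n <= m)%N ->
  (fps_inv_coefs f m)`_n = (fps_inv_coefs f n)`_n.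
Proof.
elim: m => [|m IHm]; first by rewrite leqn0 => /eqP->.
rewrite leq_eqVlt => /predU1P[-> // | lt_nm].
by rewrite /= nth_rcons size_fps_inv_coefs lt_nm IHm.
Qed.

Let fps_mulV : {in fps_unit, left_inverse 1 fps_inv *%R}.
Proof.
move=> f nz_f; rewrite mulrC /fps_inv (negPf nz_f); apply/fpsP => -[|n].
  by rewrite coef_fpsM big_ord1 /= mulfV.
rewrite coef_fpsM coef_fps1 /= big_ord_recl /= nth_rcons size_fps_inv_coefs.
rewrite ltnn eqxx mulrN mulrA mulfV // mul1r addrC; apply/eqP; rewrite subr_eq0.
apply/eqP/eq_bigr => -[i /= lt_in] _; congr (_ * _).
by rewrite /bump add1n subSS [RHS]nth_fps_inv_coefs ?leq_subr.
Qed.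

Let fps_unitPl f g : g * f = 1 -> fps_unit f.
Proof.
move/fpsP/(_ 0%N); rewrite coef_fpsM big_ord1 /= => gf1.
apply/eqP => f0; move: gf1; rewrite f0 mulr0 => /esym/eqP.
by rewrite (negPf (oner_neq0 F)).
Qed.

Let fps_inv_out : {in [predC fps_unit], fps_inv =1 id}.
Proof. by move=> f /negPn f0; rewrite /fps_inv f0. Qed.

HB.instance Definition _ := GRing.ComNzRing_hasMulInverse.Build (fps F)
  fps_mulV fps_unitPl fps_inv_out.

Definition fpsX : fps F := Fps (fun n => (n == 1%N)%:R).

End FpsRing.

Arguments fpsX {F}.

(* x / (e^x - 1) = \sum_n B_n x^n / n!, where (e^x - 1) / x is the series with
   coefficients 1 / (n+1)!. *)
Definition bernoulli (n : nat) : rat :=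
  n`!%:R * ((Fps (fun i => i.+1`!%:R^-1) : fps rat)^-1) n.

(* Harer-Zagier; meaningful for 2g - 2 + n > 0 only, in which case the
   subtraction in nat is exact. *)
Definition chi_M (g n : nat) : rat :=
  (-1) ^+ n * ((2 * g)%:R - 1) * bernoulli (2 * g) / (2 * g)`!%:R
  * (2 * g + n - 3)`!%:R.

(* A finite graph with vertex set 'I_nv weighted by genera, and half-edge set
   'I_nh: [vtx] is the vertex carrying a half-edge, and the involution [mate]
   glues half-edges into edges, its fixed points being the external edges.
   Loops and multiple edges are allowed. *)
Record graph := Graph {
  nv : nat;
  nh : nat;
  vtx : 'I_nh -> 'I_nv;
  mate : 'I_nh -> 'I_nh;
  vgenus : 'I_nv -> nat;
  mateK : involutive mate
}.

HB.instance Definition _ := gen_eqMixin graph.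
HB.instance Definition _ := gen_choiceMixin graph.

Section Graphs.

Variable G : graph.

Definition valence (v : 'I_(nv G)) : nat := #|[pred h | vtx h == v]|.

Definition nb_external : nat := #|[pred h : 'I_(nh G) | mate h == h]|.

Definition internal_edges : {set {set 'I_(nh G)}} :=
  (fun h : 'I_(nh G) => [set h; mate h]%SET) @: [pred h | mate h != h].

Definition adjacent : rel 'I_(nv G) :=
  fun v w => [exists h : 'I_(nh G), (vtx h == v) && (vtx (mate h) == w)].

Definition nb_components : nat := n_comp adjacent predT.

Definition betti1 : int :=
  #|internal_edges|%:Z - (nv G)%:Z + nb_components%:Z.

Definition genus : int := betti1 + (\sum_(v < nv G) vgenus v)%:Z.

Definition stable : bool :=
  [forall v : 'I_(nv G), (2 < 2 * vgenus v + valence v)%N].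

End Graphs.

Definition preserves_structure (G G' : graph)
    (s : 'I_(nv G) -> 'I_(nv G')) (t : 'I_(nh G) -> 'I_(nh G')) : bool :=
  [&& [forall h, vtx (t h) == s (vtx h)],
      [forall h, mate (t h) == t (mate h)]
    & [forall v, vgenus (s v) == vgenus v]].

Definition isomorphic (G G' : graph) : Prop :=
  exists (s : 'I_(nv G) -> 'I_(nv G')) (t : 'I_(nh G) -> 'I_(nh G')),
    [/\ bijective s, bijective t & preserves_structure s t].

(* External edges are unlabelled: automorphisms may permute them. *)
Definition Aut_graph (G : graph) :
    {set {perm 'I_(nv G)} * {perm 'I_(nh G)}} :=
  [set p : {perm 'I_(nv G)} * {perm 'I_(nh G)} |
     @preserves_structure G G p.1 p.2]%SET.

Definition connected_stable_graph (g n : nat) (G : graph) : Prop :=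
  [/\ nb_components G = 1%N, stable G, genus G = g%:Z & nb_external G = n].

Definition stable_graph_classes (g n : nat) : set (set graph) :=
  [set isomorphic G | G in connected_stable_graph g n]%classic.

Definition graph_weight (G : graph) : rat :=
  #|Aut_graph G|%:R^-1 * \prod_(v < nv G) chi_M (vgenus v) (valence v).

Definition empty_graph : graph :=
  @Graph 0 0 id id (fun=> 0%N) (fun=> erefl).

(* Bini-Harer.  There are finitely many isomorphism classes, because
   \sum_v (2 g_v - 2 + val_v) = 2 g - 2 + n has positive terms; [xget] picks a
   representative of the class [C], its default value being irrelevant since
   [C] is not empty. *)
Definition chi_Mbar (g n : nat) : rat :=
  n`!%:R * \sum_(C \in stable_graph_classes g n) graph_weight (xget empty_graph C).

Definition elem_sym (j : int) (s : seq int) : int :=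
  if j is Posz l then
    \sum_(J : {set 'I_(size s)} | #|J| == l) \prod_(i in J) s`_i
  else 0.

Definition log1p : fps rat :=
  Fps (fun n => if n is 0%N then 0 else (-1) ^+ n.-1 / n%:R).

Definition A_args (k : nat) (m : int) : seq int :=
  [seq j%:Z - m | j <- iota 1 k.-1].

(* The sum over -2 <= m <= k - 2 is indexed by i = m + 2, so that the bound
   l <= k - m - 1 reads l < k - i + 2. *)
Definition A_ge2 (k : nat) : fps rat :=
  \sum_(0 <= i < k.+1)
    let m : int := i%:Z - 2 in
    i`!%:R^-1 *: ((1 + fpsX) ^ (- m) *
      \sum_(0 <= l < k - i + 2)
        ((elem_sym (l%:Z + m) (A_args k m))%:~R / l`!%:R)
          *: (log1p - 1) ^+ l).

Definition A (k : nat) : fps rat :=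
  match k with
  | 0 => (1 / 2) *: ((1 + fpsX) ^+ 2 * log1p) - (1 / 2) *: fpsX
         - (3 / 4) *: fpsX ^+ 2
  | 1 => (1 / 2) *: 1 + (1 + fpsX) * (log1p - 1)
         + (1 / 2) *: ((1 + fpsX) ^+ 2 * (log1p - 1) ^+ 2)
  | _ => A_ge2 k
  end.

(* Main.v *)
Require Import Defs.
From HB Require Import structures.
From mathcomp Require Import all_boot all_order all_fingroup all_algebra.
From mathcomp Require Import finmap boolp classical_sets cardinality fsbigop.
From mathcomp Require Import fintype finset zify ring lra.

Set Implicit Arguments.
Unset Strict Implicit.
Unset Printing Implicit Defensive.

Import GRing.Theory Num.Theory.
Local Open Scope ring_scope.

(** A connected graph with V vertices has at least V - 1 edges, so genus 0
    forces all vertex genera to vanish and the graph to be a tree.  The series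
    A_k turns out to enumerate the trees with exactly k internal edges, hence
    with k + 1 vertices and, if there are n external edges, n + 2k half-edges.
    Stability of all k + 1 vertices gives 3(k + 1) <= n + 2k, that is
    k <= n - 3.

    By orbit-stabiliser, a sum over isomorphism classes weighted by 1 / |Aut|
    is the sum over labelled trees divided by (k + 1)! (n + 2k)!
    ([sum_graph_classes]).  A labelled tree is a map from half-edges to vertices
    together with an involution gluing half-edges.  When the map has fibres of
    sizes v_w, exactly prod_w v_w * (n + k - 1)! / n! involutions produce a tree
    ([card_tree_gluings]): a tree on V vertices has V - 1 edges, and contracting
    one of them gives a recurrence in V which this formula satisfies.  The sum
    over all maps is then an exponential formula ([egf_functions]), and the
    total for k internal edges is
      (n + k - 1)! / ((k + 1)! n!) * [x^(n+k-1)] W^(k+1),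
    where W = \sum_d chi(M_(0,d+1)) x^d / d! = (1 + x) log(1 + x) - x.  This is
    the coefficient of x^n in D^(k-1) W^(k+1) / (k + 1)! with D = d/dx, the form
    taken by Lagrange inversion for y = x + t W(y).

    It remains to compute D^(k-1) W^(k+1) ([A_deriv]).  With
    u = log(1 + x) - 1 one has W = (1 + x) u + 1, which is expanded by the
    binomial formula, and
      D ((1 + x)^z p(u)) = (1 + x)^(z-1) (p' + z p)(u)
    for every polynomial p.  So the iterates of D act on polynomials in u by
    products of operators d/du + a with consecutive integers a, and the
    elementary symmetric polynomials are the coefficients of such a product.
    For k = 0 the identity reads A_0' = W. *)

(** * The derivative of formal power series *)

Definition fps_deriv (f : fps rat) : fps rat := Fps (fun n => n.+1%:R * f n.+1).

Lemma fps_derivD f g : fps_deriv (f + g) = fps_deriv f + fps_deriv g.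
Proof. by apply/fpsP => n; rewrite /= mulrDr. Qed.

Lemma fps_derivZ a f : fps_deriv (a *: f) = a *: fps_deriv f.
Proof. by apply/fpsP => n; rewrite /= mulrCA. Qed.

Fact fps_deriv_is_linear : linear fps_deriv.
Proof. by move=> a f g; rewrite fps_derivD fps_derivZ. Qed.

HB.instance Definition _ :=
  GRing.isLinear.Build rat (fps rat) (fps rat) _ fps_deriv fps_deriv_is_linear.

Lemma fps_derivM f g : fps_deriv (f * g) = fps_deriv f * g + f * fps_deriv g.
Proof.
apply/fpsP => n; rewrite /= mulr_sumr.
transitivity (\sum_(i < n.+2) (i%:R * f i * g (n.+1 - i)%N
     + f i * ((n.+1 - i)%:R * g (n.+1 - i)%N))).
  apply: eq_bigr => -[i /= lt_i] _.
  have -> : n.+1%:R = i%:R + (n.+1 - i)%:R :> rat by rewrite -natrD subnKC.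
  ring.
rewrite big_split /=; congr (_ + _).
  rewrite big_ord_recl /= !mul0r add0r; apply: eq_bigr => i _.
  by rewrite /bump add1n subSS.
rewrite big_ord_recr /= subnn mul0r mulr0 addr0; apply: eq_bigr => -[i /= lt_i] _.
by rewrite subSn.
Qed.

Lemma fps_deriv1 : fps_deriv 1 = 0.
Proof. by apply/fpsP => n; rewrite /= mulr0. Qed.

Lemma fps_deriv_iter K f n :
  iter K fps_deriv f n = (n + K)`!%:R / n`!%:R * f (n + K)%N.
Proof.
elim: K n => [|K IHK] n; first by rewrite addn0 mulfV ?mul1r ?pnatr_eq0 -?lt0n ?fact_gt0.
rewrite /= IHK addSnnS factS natrM invfM.
have ? : n.+1%:R != 0 :> rat by rewrite pnatr_eq0.
have ? : n`!%:R != 0 :> rat by rewrite pnatr_eq0 -lt0n fact_gt0.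
by field; rewrite nat1r; apply/andP.
Qed.

Local Notation onePX := (1 + fpsX : fps rat).
Local Notation logm1 := (log1p - 1).

Lemma fps_derivX : fps_deriv fpsX = 1.
Proof. by apply/fpsP => -[|n]; rewrite /= ?mulr1 ?mulr0. Qed.

Lemma fps_deriv_onePX : fps_deriv onePX = 1.
Proof. by rewrite linearD /= fps_deriv1 fps_derivX add0r. Qed.

Lemma unit_onePX : onePX \is a GRing.unit.
Proof. by change (fps_coef onePX 0 != 0). Qed.

Lemma coef_fpsXM (f : fps rat) n : (fpsX * f) n = if n is n'.+1 then f n' else 0.
Proof.
rewrite coef_fpsM; case: n => [|n]; first by rewrite big_ord1 mul0r.
rewrite !big_ord_recl /= mul0r add0r mul1r big1 ?addr0 ?subSS ?subn0 // => i _.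
by rewrite mul0r.
Qed.

Lemma coef_fpsXnM (f : fps rat) k n : (fpsX ^+ k * f) (n + k)%N = f n.
Proof.
by elim: k n => [|k IHk] n; rewrite ?addn0 ?mul1r // exprS -mulrA addnS coef_fpsXM.
Qed.

Lemma deriv_log1p : onePX * fps_deriv log1p = 1.
Proof.
apply/fpsP => n; rewrite mulrDl mul1r coef_fpsD coef_fpsXM /=.
case: n => [|n] /=; first by rewrite mul1r divr1 addr0.
have ? : n.+1%:R != 0 :> rat by rewrite pnatr_eq0.
have ? : n.+2%:R != 0 :> rat by rewrite pnatr_eq0.
by rewrite exprS; field; rewrite -natrD ?nat1r; apply/andP.
Qed.

(** Stated after multiplication by 1 + x: in this form a negative power follows
    from the corresponding positive one by differentiating f^-1 * f = 1. *)
Lemma deriv_onePXz z : onePX * fps_deriv (onePX ^ z) = z%:~R *: onePX ^ z.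
Proof.
have derivXn n : onePX * fps_deriv (onePX ^+ n) = n%:R *: onePX ^+ n.
  elim: n => [|n IHn]; first by rewrite expr0 fps_deriv1 mulr0 scale0r.
  rewrite exprS fps_derivM fps_deriv_onePX mul1r mulrDr mulrCA IHn -scalerAr.
  by rewrite -[n.+1]add1n natrD scalerDl scale1r.
case: z => n; first by rewrite derivXn.
have -> : onePX ^ Negz n = (onePX ^+ n.+1)^-1 by [].
rewrite NegzE.
have Un : onePX ^+ n.+1 \is a GRing.unit by rewrite unitrX ?unit_onePX.
apply: (mulIr Un).
have := congr1 fps_deriv (mulVr Un); rewrite fps_derivM fps_deriv1.
move/(congr1 ( *%R onePX)); rewrite mulr0 mulrDr [X in _ + X]mulrCA derivXn.
rewrite -scalerAr mulVr // mulrA => /eqP; rewrite addr_eq0 => /eqP->.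
by rewrite -scalerAl mulVr // rmorphN scaleNr.
Qed.

Lemma deriv_poly_log (p : {poly rat}) :
  onePX * fps_deriv (horner_alg logm1 p) = horner_alg logm1 p^`().
Proof.
elim/poly_ind: p => [|p c IHp]; first by rewrite deriv0 !rmorph0 linear0 mulr0.
rewrite derivD derivC addr0 derivM derivX mulr1 !rmorphD !rmorphM /=.
rewrite horner_algX horner_algC.
rewrite linearD linearZ /= fps_deriv1 scaler0 addr0 fps_derivM mulrDr mulrA IHp.
by rewrite mulrCA linearB /= fps_deriv1 subr0 deriv_log1p mulr1.
Qed.

(** Writing 1 + x = e^(u+1), one has d/dx = e^(-(u+1)) d/du, which explains both
    the drop of the exponent and the polynomial p' + z p. *)
Lemma deriv_onePXz_poly z (p : {poly rat}) :
  fps_deriv (onePX ^ z * horner_alg logm1 p)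
  = onePX ^ (z - 1) * horner_alg logm1 (p^`() + z%:~R *: p).
Proof.
apply: (mulrI unit_onePX).
rewrite fps_derivM mulrDr mulrA deriv_onePXz mulrCA deriv_poly_log.
have {1 2}-> : onePX ^ z = onePX * onePX ^ (z - 1).
  by rewrite -{2}[onePX]expr1z -exprzDr ?unit_onePX //; congr (_ ^ _); ring.
rewrite linearD linearZ /= mulr_algl mulrDr mulrDr addrC.
by rewrite -!scalerAr -scalerAl !mulrA.
Qed.

(** Vieta: the elementary symmetric polynomials have prod_a (1 + a X) as
    generating polynomial, which makes their recurrence in the list of arguments
    immediate. *)
Lemma elem_symE (l : nat) s :
  elem_sym l s = (\prod_(a <- s) (1 + a *: 'X))`_l.
Proof.
under [in RHS]eq_bigr do rewrite addrC.
rewrite /elem_sym (big_nth 0) big_mkord bigA_distr coef_sum [LHS]big_mkcond.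
apply: eq_bigr => J _.
rewrite -(big_mkcond (mem J) (fun i : 'I_(size s) => s`_i *: 'X)) /=.
rewrite scaler_prod prodr_const coefZ coefXn eq_sym.
by case: eqP => _; rewrite ?mulr1 ?mulr0.
Qed.

Lemma elem_sym_gt (l : nat) s : (size s < l)%N -> elem_sym l s = 0.
Proof.
move=> lt_sl; apply: big_pred0 => J; apply/eqP => eqJ.
by have := max_card (mem J); rewrite eqJ card_ord leqNgt lt_sl.
Qed.

Lemma elem_sym_nil j : elem_sym j [::] = (j == 0)%:R.
Proof.
by case: j => [l|l] //; rewrite elem_symE big_nil coef1.
Qed.

Lemma elem_sym_cons j a s :
  elem_sym j (a :: s) = elem_sym j s + a * elem_sym (j - 1) s.
Proof.
case: j => [l|l]; last first.
  have -> : Negz l - 1 = Negz l.+1 by rewrite !NegzE; lia.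
  by rewrite /= mulr0.

  rewrite elem_symE big_cons mulrDl mul1r -scalerAl coefD coefZ coefXM -elem_symE.
  case: l => [|l] //; have -> : l.+1%:Z - 1 = l by lia.
  by rewrite -elem_symE.
Qed.

(** The composite of the commuting operators d/dX + a, for a in s. *)
Definition diffop (s : seq int) (p : {poly rat}) :=
  foldr (fun a q => q^`() + a%:~R *: q) p s.

(** The composite is \sum_r e_(|s|-r)(s) (d/dX)^r, and on X^j only r = j - l
    contributes to degree l.  When l > j, resp. j - l > |s|, the index exceeds |s|,
    resp. is negative, and the elementary symmetric polynomial vanishes. *)
Lemma coef_diffopXn s j l :
  (diffop s 'X^j)`_l =
    (elem_sym (l%:Z + (size s)%:Z - j%:Z) s)%:~R * (j`!%:R / l`!%:R).
Proof.
have nzf m : m`!%:R != 0 :> rat by rewrite pnatr_eq0 -lt0n fact_gt0.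
elim: s l => [|a s IHs] l.
  rewrite [diffop _ _]/= [size _]/= elem_sym_nil coefXn addr0 subr_eq0 eqz_nat.
  by case: eqP => [->|_]; rewrite ?mul0r // mulfV ?mulr1.
rewrite -[diffop _ _]/((diffop s 'X^j)^`() + a%:~R *: diffop s 'X^j).
rewrite coefD coef_deriv coefZ !IHs elem_sym_cons [size (_ :: _)]/= intrD intrM.
have -> : l%:Z + (size s).+1%:Z - j%:Z - 1 = l%:Z + (size s)%:Z - j%:Z by lia.
have -> : l.+1%:Z + (size s)%:Z - j%:Z = l%:Z + (size s).+1%:Z - j%:Z by lia.
rewrite -mulr_natl factS natrM.
have ? : l.+1%:R != 0 :> rat by rewrite pnatr_eq0.
by field; rewrite nat1r; apply/andP.
Qed.

Lemma deriv_iter_onePX_log j K :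
  iter K fps_deriv (onePX ^ j%:Z * logm1 ^+ j)
  = onePX ^ (j%:Z - K%:Z) *
    horner_alg logm1 (diffop [seq (j%:Z - K%:Z) + i%:Z | i <- iota 1 K] 'X^j).
Proof.
elim: K => [|K IHK]; first by rewrite subr0 /= rmorphXn /= horner_algX.
have argsS : [seq (j%:Z - K%:Z) + i%:Z | i <- iota 1 K]
    = [seq (j%:Z - K.+1%:Z) + i%:Z | i <- iota 2 K].
  by rewrite (iotaDl 1 1) -map_comp; apply: eq_map => i /=; lia.
rewrite /= IHK deriv_onePXz_poly argsS.
congr (onePX ^ _ * horner_alg logm1 (_ + _)); first by lia.
congr (_%:~R *: _); lia.
Qed.

Lemma horner_diffop s j :
  horner_alg logm1 (diffop s 'X^j) = \sum_(0 <= l < j.+1)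
    ((elem_sym (l%:Z + (size s)%:Z - j%:Z) s)%:~R * (j`!%:R / l`!%:R)) *: logm1 ^+ l.
Proof.
have -> : diffop s 'X^j = \poly_(l < j.+1)
    ((elem_sym (l%:Z + (size s)%:Z - j%:Z) s)%:~R * (j`!%:R / l`!%:R)).
  apply/polyP => l; rewrite coef_poly coef_diffopXn; case: ltnP => // lt_jl.
  have -> : l%:Z + (size s)%:Z - j%:Z = (size s + (l - j))%N by lia.
  by rewrite elem_sym_gt ?mul0r //; lia.
rewrite poly_def rmorph_sum big_mkord; apply: eq_bigr => l _.
by rewrite [LHS]linearZ /= rmorphXn /= horner_algX mulr_algl.
Qed.

Fact iter_deriv_is_linear K : linear (iter K fps_deriv).
Proof. by elim: K => [|K IHK] a f g //=; rewrite IHK linearP. Qed.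

HB.instance Definition _ K :=
  GRing.isLinear.Build rat (fps rat) (fps rat) _ (iter K fps_deriv)
    (iter_deriv_is_linear K).

(** The series W = \sum_d chi(M_(0,d+1)) x^d / d!, derivative of the generating
    function of a single vertex. *)
Definition vertex_deriv : fps rat := onePX * logm1 + 1.

(** The i-th summand of A_k comes from the term of index i in the binomial
    expansion of ((1 + x) u + 1)^(k+1), that is from ((1 + x) u)^(k+1-i).  For
    k >= 2 the last term i = k + 1 is the constant 1, killed by D^(k-1); this is
    why the range of m stops at k - 2.  For k = 1 there is no derivative and the
    constant survives as the 1/2 of A_1. *)
Lemma A_deriv k : (0 < k)%N ->
  A k = (k.+1)`!%:R^-1 *: iter k.-1 fps_deriv (vertex_deriv ^+ k.+1).
Proof.
case: k => [//|[_|k _]].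
  rewrite /= /vertex_deriv sqrrD1 exprMn (_ : 2`!%:R^-1 = 1 / 2 :> rat) //.
  rewrite !mul1r -scaler_nat !scalerDr scalerA (_ : 1 / 2 * 2%:R = 1 :> rat) // scale1r.
  by rewrite addrC [X in _ + X]addrC addrA.
set K := k.+2; rewrite -[A K]/(A_ge2 K) /A_ge2.
rewrite /vertex_deriv exprDn linear_sum /= big_ord_recr /= subnn expr0 mul1r expr1n.
rewrite binn mulr1n.
have -> : fps_deriv (iter k fps_deriv 1) = 0.
  by rewrite -iterS iterSr fps_deriv1 linear0.
rewrite addr0 big_mkord scaler_sumr; apply: eq_bigr => -[i /= lt_i] _.
rewrite expr1n mulr1 -iterS [in RHS]linearMn /= -iterS exprMn.
have := deriv_iter_onePX_log (K.+1 - i) k.+1.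
rewrite -[onePX ^ (_ - _)%N%:Z]/(onePX ^+ (K.+1 - i)) => ->.
rewrite horner_diffop size_map size_iota.
have -> : (K.+1 - i)%N%:Z - k.+1%:Z = - (i%:Z - 2) by lia.
rewrite -scaler_nat scalerA.
have -> : (K.+1 - i).+1 = (K - i + 2)%N by lia.
rewrite !scalerAr; congr (_ * _); rewrite !scaler_sumr; apply: eq_bigr => l _.
rewrite !scalerA; congr (_ *: _).
have -> : [seq - (i%:Z - 2) + i0%:Z | i0 <- iota 1 k.+1] = A_args K (i%:Z - 2).
  by apply: eq_map => x /=; lia.
have -> : l%:Z + k.+1%:Z - (K.+1 - i)%N%:Z = l%:Z + (i%:Z - 2) by lia.
have nzf m : m`!%:R != 0 :> rat by rewrite pnatr_eq0 -lt0n fact_gt0.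
rewrite -(bin_fact (ltnW lt_i)) !natrM.
have ? : 'C(K.+1, i)%:R != 0 :> rat by rewrite pnatr_eq0 -lt0n bin_gt0 ltnW.
by field; rewrite !nzf.
Qed.

Lemma vertex_derivE : vertex_deriv = onePX * log1p - fpsX.
Proof. by rewrite /vertex_deriv; ring. Qed.

Lemma coef_vertex_deriv n :
  vertex_deriv n = if (n < 2)%N then 0 else (-1) ^+ n / (n * n.-1)%:R.
Proof.
rewrite vertex_derivE mulrDl mul1r !coef_fpsD coef_fpsXM.
case: n => [|[|n]] //=; rewrite oppr0 addr0 natrM.
have ? : n.+1%:R != 0 :> rat by rewrite pnatr_eq0.
have ? : n.+2%:R != 0 :> rat by rewrite pnatr_eq0.
by rewrite !exprS; field; rewrite -natrD nat1r; apply/andP.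
Qed.

Lemma deriv_A0 : fps_deriv (A 0) = vertex_deriv.
Proof.
rewrite vertex_derivE /A !linearB !linearZ /= fps_derivM expr2 fps_derivM fps_deriv_onePX.
rewrite -[onePX * onePX * _]mulrA deriv_log1p fps_derivX expr2 fps_derivM fps_derivX.
rewrite !mul1r !mulr1 [(onePX + onePX) * _]mulrDl.
apply/fpsP => n; rewrite !(coef_fpsD, coef_fpsN, coef_fpsZ).
by move: ((onePX * log1p) n) (fpsX n : rat) ((1 : fps rat) n) => a b c; field.
Qed.

Lemma coef_A k n : (0 < n)%N ->
  A k n = (n + k).-1`!%:R / (k.+1`!%:R * n`!%:R) * (vertex_deriv ^+ k.+1) (n + k).-1.
Proof.
have nzf m : m`!%:R != 0 :> rat by rewrite pnatr_eq0 -lt0n fact_gt0.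
case: n => // n _; case: k => [|k]; last first.
  by rewrite A_deriv // coef_fpsZ fps_deriv_iter -!addSnnS /=; field; rewrite !nzf.
rewrite addn0 expr1 -deriv_A0 (_ : 1`! = 1)%N // mul1r [n.+1.-1]/= [n.+1`!]factS natrM.
rewrite -[fps_deriv _ n]/(n.+1%:R * A 0 n.+1).
have ? : n.+1%:R != 0 :> rat by rewrite pnatr_eq0.
by field; rewrite nat1r nzf; apply/andP.
Qed.

(** * Maps weighted by the sizes of their fibres *)

Definition egf (phi : nat -> rat) : fps rat := Fps (fun d => phi d / d`!%:R).

Lemma sum_subsets_card (T : finType) (S : {set T}) (F : nat -> rat) :
  \sum_(B : {set T} | B \subset S) F #|B| = \sum_(i < #|S|.+1) 'C(#|S|, i)%:R * F i.
Proof.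
rewrite (partition_big (fun B : {set T} => inord #|B| : 'I_#|S|.+1) xpredT) //=.
apply: eq_bigr => i _.
transitivity (\sum_(B in [set B : {set T} | B \subset S & #|B| == i]) F i).
  apply: eq_big => [B|B /andP[sBS /eqP<-]]; last by rewrite inordK ?ltnS ?subset_leq_card.
  rewrite inE; case sBS: (B \subset S) => //=.
  by rewrite -val_eqE /= inordK // ltnS subset_leq_card.
by rewrite sumr_const cards_draws mulr_natl.
Qed.

(** Induction on W, removing one w at a time: a map S -> W is a subset B of S,
    the fibre of w, together with a map from the complement of B to W minus w,
    which is the product formula for exponential generating functions.  Maps on
    S are represented by total functions equal to t0 outside S. *)
Lemma egf_functions_sets (H T : finType) (phi : nat -> rat) (t0 : T)
    (W : {set T}) (S : {set H}) :
  \sum_(c : {ffun H -> T} | [forall h, c h \in if h \in S then W else [set t0]])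
     \prod_(i in W) phi #|[set h in S | c h == i]|
  = #|S| `!%:R * (egf phi ^+ #|W|) #|S|.
Proof.
have nzf m : m`!%:R != 0 :> rat by rewrite pnatr_eq0 -lt0n fact_gt0.
move cardW: #|W| => k; elim: k W S cardW => [|k IHk] W S cardW.
  have -> : W = set0 by apply/eqP; rewrite -cards_eq0 cardW.
  rewrite expr0 coef_fps1; case: posnP => [S0|S_gt0].
    have {S0}->: S = set0 by apply/eqP; rewrite -cards_eq0 S0.
    rewrite (big_pred1 [ffun=> t0]) ?big_set0 ?cards0 ?mulr1 // => c.
    apply/forallP/eqP => [c0 | -> h]; last by rewrite inE ffunE inE.
    by apply/ffunP => h; have := c0 h; rewrite inE ffunE inE => /eqP.
  rewrite mulr0 big_pred0 // => c; apply/negP => /forallP Wc.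
  have [h Sh] := card_gt0P S_gt0.
  by have := Wc h; rewrite Sh inE.
have [w Ww] : {w | w \in W} by apply/sigW/card_gt0P; rewrite cardW.
have cardW' : #|W :\ w| = k by move: cardW; rewrite (cardsD1 w) Ww => -[].
rewrite (partition_big (fun c : {ffun H -> T} => [set h in S | c h == w])
  (fun B => B \subset S)) /=; last first.
  by move=> c _; apply/subsetP => h; rewrite inE => /andP[].
transitivity (\sum_(B : {set H} | B \subset S)
    phi #|B| * ((#|S| - #|B|)`!%:R * (egf phi ^+ k) (#|S| - #|B|)%N)).
  apply: eq_bigr => B sBS.
  have SB_B h : h \in B -> h \in S by apply/subsetP.
  have <- : #|S :\: B| = (#|S| - #|B|)%N by rewrite cardsD (setIidPr sBS).
  rewrite -(IHk _ _ cardW') mulr_sumr.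
  rewrite (reindex_onto (fun c : {ffun H -> T} => [ffun h => if h \in B then w else c h])
     (fun c : {ffun H -> T} => [ffun h => if h \in B then t0 else c h])) /=; last first.
    move=> c /andP[cSW /eqP <-]; apply/ffunP => h; rewrite !ffunE inE.
    by case: ifP => [/andP[_ /eqP-> ] | ->].
  apply: eq_big => [c | c /andP[/andP[cSW /eqP defB] c0]].
    apply/andP/forallP => [[/andP[/forallP cSW /eqP defB] /eqP c0] h | cSW].
      have := cSW h; have /ffunP/(_ h) := c0; have /setP/(_ h) := defB.
      rewrite !inE !ffunE; case: ifP => [Bh _ <- _ | Bh].
        by rewrite inE.
      by case: (h \in S) => //= cw _; rewrite !inE cw.
    split.
      apply/andP; split.
        apply/forallP => h; have := cSW h; rewrite !inE ffunE.
        have [Bh _ | _ /=] := boolP (h \in B); first by rewrite (SB_B _ Bh).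
        by case: (h \in S); rewrite // !inE => /andP[].
      apply/eqP/setP => h; have := cSW h; rewrite !inE ffunE.
      have [Bh _ | _ /=] := boolP (h \in B); first by rewrite (SB_B _ Bh) eqxx.
      by case: (h \in S); rewrite // !inE => /andP[/negPf].
    apply/eqP/ffunP => h; have := cSW h; rewrite !ffunE inE.
    by have [Bh | //] := boolP (h \in B); rewrite /= inE => /eqP.
  rewrite (big_setD1 w) //= defB; congr (_ * _).
  apply: eq_bigr => i; rewrite !inE => /andP[iw _]; congr (phi _).
  apply: eq_card => h; rewrite !inE ffunE; case: ifP => //= _.
  by rewrite eq_sym (negPf iw) andbF.
rewrite (sum_subsets_card S
  (fun i => phi i * ((#|S| - i)`!%:R * (egf phi ^+ k) (#|S| - i)%N))).
rewrite exprS coef_fpsM mulr_sumr; apply: eq_bigr => -[i /= lt_i] _.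
rewrite -(bin_fact (_ : i <= #|S|)%N) // !natrM.
by field; rewrite nzf.
Qed.

Lemma egf_functions (H T : finType) (t0 : T) (phi : nat -> rat) :
  \sum_(c : {ffun H -> T}) \prod_i phi #|[pred h | c h == i]|
  = #|H| `!%:R * (egf phi ^+ #|T|) #|H|.
Proof.
have := egf_functions_sets phi t0 [set: T] [set: H]; rewrite !cardsT => <-.
apply: eq_big => [c | c _]; first by apply/esym/forallP => h; rewrite !inE.
apply: eq_big => i; rewrite ?inE // => _.
by congr phi; apply: eq_card => h; rewrite !inE.
Qed.

(** * Gluing half-edges into a tree *)

Definition moved (H : finType) (f : {perm H}) : {set H} := [set h | f h != h].

Definition edge_closed (H V : finType) (c : H -> V) (f : {perm H}) (P : {set V}) :=
  [forall h, (c h \in P) == (c (f h) \in P)].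

(** Connectedness is expressed by closed sets of vertices instead of paths,
    because closed sets are easily transported through edge contractions. *)
Definition edge_connected (H V : finType) (W : {set V}) (c : H -> V) (f : {perm H}) :=
  [forall P : {set V}, edge_closed c f P ==> (W \subset P) || [disjoint W & P]].

(** The 2-cycles of a gluing are the internal edges; the points of S that it
    fixes are the external edges. *)
Definition gluing (H : finType) (S : {set H}) (f : {perm H}) :=
  [forall h, f (f h) == h] && (moved f \subset S).

(** The last condition says that there are #|W| - 1 internal edges. *)
Definition tree_gluings (H V : finType) (S : {set H}) (W : {set V}) (c : H -> V) :=
  [set f : {perm H} |
    [&& gluing S f, edge_connected W c f & #|moved f| + 2 == 2 * #|W|]%N].

(** The vertex map of a contraction: the merged vertex keeps the name i, so that no
    quotient of the type of vertices is needed. *)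
Definition merge_vtx (H V : finType) (c : H -> V) (i j : V) : H -> V :=
  fun h => if c h == j then i else c h.

Section Contraction.
Variables (H V : finType) (c : H -> V) (f : {perm H}) (a b : H).
Hypotheses (fa : f a = b) (fb : f b = a) (ab : a != b).
Let g : {perm H} := (tperm a b * f)%g.

(** Composing with the transposition of its two ends erases the edge {a, b}, which
    describes both deletion and contraction at the level of involutions. *)
Lemma cut_edgeE h : g h = if (h == a) || (h == b) then h else f h.
Proof.
rewrite permM; case: tpermP => [->|->|/eqP/negPf-> /eqP/negPf-> //].
  by rewrite fb eqxx.
by rewrite fa eqxx orbT.
Qed.

Lemma moved_cut_edge : moved f = a |: (b |: moved g).
Proof.
apply/setP => h; rewrite !inE cut_edgeE.
have [->|ha] := eqVneq h a; first by rewrite fa eq_sym ab.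
by have [->|hb] := eqVneq h b; first by rewrite fb ab.
Qed.

Lemma card_moved_cut_edge : #|moved f| = (#|moved g|).+2.
Proof.
rewrite moved_cut_edge !cardsU1 !inE !cut_edgeE !eqxx orbT /= (negPf ab).
by rewrite eqxx.
Qed.

Lemma gluing_cut_edge (S : {set H}) : a \in S -> b \in S ->
  gluing S f = gluing (S :\ a :\ b) g.
Proof.
move=> Sa Sb; rewrite /gluing moved_cut_edge !subUset !sub1set Sa Sb /=.
rewrite !subsetD1 !inE !cut_edgeE !eqxx orbT /= !eqxx !andbT; congr (_ && _).
have fab h : ((f h == a) || (f h == b)) = ((h == a) || (h == b)).
  by rewrite -{1}fb -{2}fa !(inj_eq perm_inj) orbC.
apply: eq_forallb => h; rewrite !cut_edgeE.
have [hab|/negPf hab] := boolP ((h == a) || (h == b)); last by rewrite fab hab.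
by rewrite hab eqxx; case/orP: hab => /eqP->; rewrite ?fa ?fb ?fa eqxx.
Qed.

Lemma edge_closed_cut_loop P : c a = c b -> edge_closed c g P -> edge_closed c f P.
Proof.
move=> cab /forallP cg; apply/forallP => h; have := cg h; rewrite cut_edgeE.
have [->|ha] := eqVneq h a; first by rewrite fa cab.
by have [->|hb] := eqVneq h b; first by rewrite fb cab.
Qed.

Lemma edge_connected_cut_loop (W : {set V}) :
  c a = c b -> edge_connected W c f -> edge_connected W c g.
Proof.
move=> cab /forallP cf; apply/forallP => P; apply/implyP => cg.
exact: implyP (cf P) (edge_closed_cut_loop cab cg).
Qed.

(** A closed set of the original graph contains both or neither of the two
    endpoints of the edge, so closed sets correspond before and after
    contraction. *)
Lemma edge_connected_contract (W : {set V}) :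
  c a != c b -> c a \in W -> c b \in W ->
  edge_connected W c f = edge_connected (W :\ c b) (merge_vtx c (c a) (c b)) g.
Proof.
move=> cab Wa Wb; set c' := merge_vtx c _ _.
apply/forallP/forallP => cf P; apply/implyP => clP.
  pose Q := [set v | (if v == c b then c a else v) \in P].
  have cQ h : (c h \in Q) = (c' h \in P) by rewrite inE.
  have clQ : edge_closed c f Q.
    apply/forallP => h; have := forallP clP h; rewrite cut_edgeE !cQ.
    have [->|ha] := eqVneq h a; first by rewrite fa /c' /merge_vtx eqxx (negPf cab).
    by have [->|hb] := eqVneq h b; first by rewrite fb /c' /merge_vtx eqxx (negPf cab).
  have /orP[sWQ|dWQ] := implyP (cf Q) clQ; apply/orP.
    left; apply/subsetP => v; rewrite !inE => /andP[vb /(subsetP sWQ)].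
    by rewrite inE (negPf vb).
  right; rewrite disjoint_subset; apply/subsetP => v; rewrite !inE => /andP[vb Wv].
  by have := disjointFr dWQ Wv; rewrite inE (negPf vb) => ->.
have Pab : (c a \in P) = (c b \in P) by have := forallP clP a; rewrite fa => /eqP.
have cP h : (c' h \in P) = (c h \in P).
  by rewrite /c' /merge_vtx; case: eqP => // ->.
have clP' : edge_closed c' g P.
  apply/forallP => h; have := forallP clP h; rewrite cut_edgeE !cP.
  by case: ifP.
have /orP[sWP|dWP] := implyP (cf P) clP'; apply/orP.
  left; apply/subsetP => v Wv; have [->|vb] := eqVneq v (c b).
    by rewrite -Pab (subsetP sWP) // !inE cab.
  by rewrite (subsetP sWP) // !inE vb.
right; rewrite disjoint_subset; apply/subsetP => v Wv; rewrite inE.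
have [->|vb] := eqVneq v (c b).
  by rewrite -Pab (disjointFr dWP) // !inE cab.
by rewrite (disjointFr dWP) // !inE vb.
Qed.

End Contraction.

Lemma merge_sub (H V : finType) (S : {set H}) (W : {set V}) (c : H -> V) a b :
  {in S, forall h, c h \in W} -> a \in S -> c a != c b ->
  {in S :\ a :\ b, forall h, merge_vtx c (c a) (c b) h \in W :\ c b}.
Proof.
move=> SW Sa cab h; rewrite !inE /merge_vtx => /and3P[_ _ Sh].
by case: ifP => [_|->]; rewrite ?cab SW.
Qed.

Lemma gluing_inv (H : finType) (S : {set H}) f a :
  gluing S f -> f a != a -> [/\ f (f a) = a, a != f a, a \in S & f a \in S].
Proof.
case/andP=> /forallP/(_ a)/eqP fb /subsetP sfS ab.
by split; rewrite // 1?eq_sym // sfS // inE // fb eq_sym.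
Qed.

(** A connected graph has at least #|W| - 1 edges.  By induction on the number of
    edges: deleting a loop preserves connectedness, and contracting any other
    edge decreases the numbers of edges and of vertices by one. *)
Lemma edge_connected_bound (H V : finType) (S : {set H}) (W : {set V}) (c : H -> V)
    (f : {perm H}) :
  gluing S f -> {in S, forall h, c h \in W} -> edge_connected W c f ->
  (2 * #|W| <= #|moved f| + 2)%N.
Proof.
move Dm: #|moved f| => m; have [p le_mp] := ubnP m.
elim: p => // p IHp in m le_mp S W c f Dm * => glf SW cf.
have [f0 | [a]] := set_0Vmem (moved f).
  rewrite -Dm f0 cards0; case: (set_0Vmem W) => [->|[w Ww]]; first by rewrite cards0.
  have : edge_closed c f [set w].
    apply/forallP => h; have /setP/(_ h) := f0; rewrite !inE.
    by move/negbFE/eqP=> ->.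
  move/(implyP (forallP cf _)) => /orP[/subset_leq_card | /disjointFr/(_ Ww)].
    by rewrite cards1; lia.
  by rewrite inE eqxx.
rewrite inE => fa; have [fb ab Sa Sb] := gluing_inv glf fa.
have cardf := card_moved_cut_edge erefl fb ab.
rewrite (gluing_cut_edge erefl fb ab Sa Sb) in glf.
set g := (tperm _ _ * f)%g in cardf glf.
have lt_gp : (#|moved g| < p)%N by lia.
have [cab | cab] := eqVneq (c a) (c (f a)).
  have cg := edge_connected_cut_loop erefl fb cab cf.
  have SW' : {in S :\ a :\ f a, forall h, c h \in W}.
    by move=> h; rewrite !inE => /and3P[_ _]; apply: SW.
  have := IHp _ lt_gp _ W c g erefl glf SW' cg; lia.
rewrite (edge_connected_contract erefl fb cab) ?SW // in cf.
have := IHp _ lt_gp _ _ _ g erefl glf (merge_sub SW Sa cab) cf.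
have := cardsD1 (c (f a)) W; rewrite SW //; lia.
Qed.

(** Deleting a loop would leave a connected graph with too few edges. *)
Lemma tree_gluing_no_loop (H V : finType) (S : {set H}) (W : {set V}) (c : H -> V) f a :
  {in S, forall h, c h \in W} -> f \in tree_gluings S W c -> f a != a -> c a != c (f a).
Proof.
move=> SW; rewrite inE => /and3P[glf cf /eqP card_f] fa.
have [fb ab Sa Sb] := gluing_inv glf fa.
apply/eqP => cab.
have cardf := card_moved_cut_edge erefl fb ab.
rewrite (gluing_cut_edge erefl fb ab Sa Sb) in glf.
have cg := edge_connected_cut_loop erefl fb cab cf.
have SW' : {in S :\ a :\ f a, forall h, c h \in W}.
  by move=> h; rewrite !inE => /and3P[_ _]; apply: SW.
have := edge_connected_bound glf SW' cg; lia.
Qed.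

(** Contracting the edge {a, b} is a bijection from the trees that contain it
    onto the trees of the contracted data; on involutions it is multiplication by
    the transposition of a and b. *)
Lemma card_tree_gluings_edge (H V : finType) (S : {set H}) (W : {set V}) (c : H -> V) a b :
  {in S, forall h, c h \in W} -> a \in S -> b \in S -> c a != c b ->
  #|[set f in tree_gluings S W c | f a == b]|
  = #|tree_gluings (S :\ a :\ b) (W :\ c b) (merge_vtx c (c a) (c b))|.
Proof.
move=> SW Sa Sb cab; have ab : a != b by apply: contraNneq cab => ->.
rewrite -(card_imset _ (mulgI (tperm a b))); apply: eq_card => g.
rewrite -[g](mulKg (tperm a b)) tpermV; set f := (tperm a b * g)%g.
rewrite mem_imset; last exact: mulgI.
have eq_trees : f a = b -> f b = a ->
  (f \in tree_gluings S W c) = ((tperm a b * f)%g \in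
     tree_gluings (S :\ a :\ b) (W :\ c b) (merge_vtx c (c a) (c b))).
  move=> fa fb; rewrite !inE -(gluing_cut_edge fa fb ab Sa Sb).
  rewrite -(edge_connected_contract fa fb cab) ?SW //.
  rewrite (card_moved_cut_edge fa fb ab) (cardsD1 (c b) W) SW //.
  by do 2!congr (_ && _); apply/eqP/eqP; lia.
apply/idP/idP.
  rewrite inE => /andP[ft /eqP fa]; have := ft; rewrite inE => /and3P[glf _ _].
  by rewrite -eq_trees // -fa; apply/eqP; case/andP: glf => /forallP.
move=> gt; have /setIdP[/andP[_ gS] _] := gt.
have tfix h : h \notin S :\ a :\ b -> f (tperm a b h) = h.
  move=> Sh; apply/eqP; rewrite -permM; apply: contraNT Sh => fh.
  by apply: (subsetP gS); rewrite inE.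
have fa : f a = b by rewrite -{1}(tpermR a b) tfix // !inE eqxx.
have fb : f b = a by rewrite -{1}(tpermL a b) tfix // !inE eqxx andbF.
by rewrite inE eq_trees // gt fa eqxx.
Qed.

Definition fibre_size (H V : finType) (S : {set H}) (c : H -> V) (w : V) :=
  #|[set h in S | c h == w]|.

Lemma sum_fibres (H V : finType) (S : {set H}) (W : {set V}) (c : H -> V) (F : V -> rat) :
  {in S, forall h, c h \in W} ->
  \sum_(a in S) F (c a) = \sum_(i in W) (fibre_size S c i)%:R * F i.
Proof.
move=> SW; rewrite (partition_big c (mem W)) //=; apply: eq_bigr => i Wi.
rewrite (eq_bigr (fun=> F i)) => [|h /andP[_ /eqP-> //]].
rewrite sumr_const mulr_natl; congr (_ *+ _); apply: eq_card => h.
by rewrite inE.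
Qed.

Lemma fibre_size_merge (H V : finType) (S : {set H}) (c : H -> V) a b w :
  a \in S -> b \in S -> c a != c b -> w != c b ->
  fibre_size (S :\ a :\ b) (merge_vtx c (c a) (c b)) w
  = if w == c a then (fibre_size S c (c a) + fibre_size S c (c b) - 2)%N
    else fibre_size S c w.
Proof.
move=> Sa Sb cab wb; rewrite /fibre_size; case: eqVneq => [->|wa].
  have -> : [set h in S :\ a :\ b | merge_vtx c (c a) (c b) h == c a]
    = ([set h in S | c h == c a] :\ a) :|: ([set h in S | c h == c b] :\ b).
    apply/setP => h; rewrite !inE /merge_vtx.
    have [->|hb] := eqVneq h b; first by rewrite /= [c b == c a]eq_sym (negPf cab) !andbF.
    have [->|ha] := eqVneq h a; first by rewrite /= (negPf cab) !andbF.
    rewrite /=; have [eqb|] := eqVneq (c h) (c b).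
      by rewrite eqxx andbT orbC; case: (h \in S).
    by rewrite andbF orbF.
  rewrite cardsU disjoint_setI0 ?cards0; last first.
    rewrite disjoint_subset; apply/subsetP => h; rewrite !inE => /and3P[_ _ /eqP->].
    by rewrite (negPf cab) !andbF.
  have := cardsD1 a [set h in S | c h == c a]; have := cardsD1 b [set h in S | c h == c b].
  rewrite !inE Sa Sb !eqxx /= => -> ->; lia.
apply: eq_card => h; rewrite !inE /merge_vtx.
have [->|hb] := eqVneq h b.
  by rewrite eqxx [c a == w]eq_sym (negPf wa) [c b == w]eq_sym (negPf wb) !andbF.
have [->|ha] := eqVneq h a.
  by rewrite (negPf cab) [c a == w]eq_sym (negPf wa) !andbF.
rewrite /=; have [->|] := eqVneq (c h) (c b) => //.
by rewrite [c a == w]eq_sym (negPf wa) [c b == w]eq_sym (negPf wb).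
Qed.

(** The arithmetic behind the recurrence for trees: contracting an edge between
    i and j creates a vertex of valence v_i + v_j - 2. *)
Lemma sum_merged_fibres (V : finType) (W : {set V}) (v : V -> rat) :
  \sum_(i in W) \sum_(j in W | i != j) (v i + v j - 2)
  = 2 * (#|W|%:R - 1) * (\sum_(i in W) v i - #|W|%:R).
Proof.
have sum1 : \sum_(i in W) (v i - 1) = \sum_(i in W) v i - #|W|%:R.
  by rewrite sumrB sumr_const.
rewrite -sum1; set T := \sum_(i in W) (v i - 1).
transitivity (\sum_(i in W) ((#|W|%:R - 1) * (v i - 1) + (T - (v i - 1)))).
  apply: eq_bigr => i Wi.
  have -> : T = (v i - 1) + \sum_(j in W | j != i) (v j - 1).
    by rewrite /T (bigD1 i).
  rewrite [v i - 1 + _]addrC addrK (cardsD1 i) Wi.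
  rewrite [(true + _)%:R]natrD [_ + _ - _]addrC addKr.
  have -> : \sum_(j in W | i != j) (v i + v j - 2)
      = \sum_(j in W | j != i) ((v i - 1) + (v j - 1)).
    by apply: eq_big => [j|j _]; [rewrite eq_sym | ring].
  rewrite big_split /= sumr_const mulr_natl; congr (_ *+ _ + _).
  by apply: eq_card => j; rewrite !inE andbC.
rewrite big_split /= -mulr_sumr -/T sumrB sumr_const -/T -mulr_natl; ring.
Qed.

(** Double counting of the trees with a distinguished oriented edge (a, b). *)
Lemma sum_card_moved (H V : finType) (S : {set H}) (W : {set V}) (c : H -> V) :
  {in S, forall h, c h \in W} ->
  (\sum_(f in tree_gluings S W c) #|moved f|
   = \sum_(a in S) \sum_(b in S | c a != c b)
       #|tree_gluings (S :\ a :\ b) (W :\ c b) (merge_vtx c (c a) (c b))|)%N.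
Proof.
move=> SW.
transitivity (\sum_(f in tree_gluings S W c)
  \sum_(a in S) \sum_(b in S | c a != c b) (f a == b))%N.
  apply: eq_bigr => f ft; have := ft; rewrite inE => /and3P[glf _ _].
  rewrite -sum1_card big_mkcond [RHS]big_mkcond /=; apply: eq_bigr => a _.
  rewrite inE; have [fa | fa] := eqVneq (f a) a.
    case: ifP => // Sa; rewrite big1 // => b /andP[_ cab].
    by case: eqP => // fab; rewrite -fab fa eqxx in cab.
  have [_ _ Sa Sfa] := gluing_inv glf fa.
  rewrite Sa (bigD1 (f a)) ?Sfa ?(tree_gluing_no_loop SW ft) //= eqxx big1 // => b.
  by case/andP=> _; rewrite eq_sym => /negPf->.
rewrite exchange_big; apply: eq_bigr => a Sa.
rewrite exchange_big; apply: eq_bigr => b /andP[Sb cab].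
rewrite -card_tree_gluings_edge // -sum1_card big_mkcond [RHS]big_mkcond.
by apply: eq_bigr => f _; rewrite inE; case: (f \in _); case: eqP.
Qed.

(** Let V = #|W| and N be the number of trees.  Counting trees with an oriented
    edge in two ways gives
      2 (V - 1) N = \sum_(a, b) N_(a,b),
    with N_(a,b) the number of trees after contraction.  By induction the right
    hand side is a sum over ordered pairs of distinct vertices of
    (v_i + v_j - 2) times a factor independent of i and j, evaluated by
    [sum_merged_fibres].  Valences at least 2 are preserved by contraction, since
    v_i + v_j - 2 >= 2, and make all truncated subtractions exact. *)
Lemma card_tree_gluings (H V : finType) (S : {set H}) (W : {set V}) (c : H -> V) :
  (0 < #|W|)%N -> {in S, forall h, c h \in W} ->
  {in W, forall w, (1 < fibre_size S c w)%N} ->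
  #|tree_gluings S W c|%:R * (#|S| + 2 - 2 * #|W|)`!%:R
  = \prod_(w in W) (fibre_size S c w)%:R * (#|S| - #|W|)`!%:R :> rat.
Proof.
case DW: #|W| => [//|k] _; elim: k S W c DW => [|k IHk] S W c DW SW v2.
  have [w eqW] : exists w, W = [set w] by apply/cards1P/eqP.
  have trees1 : tree_gluings S W c = [set 1%g].
    apply/setP => f; rewrite !inE DW; apply/and3P/eqP => [[_ _]|->].
      rewrite -[(2 * 1)%N]add0n eqn_add2r cards_eq0 => /eqP/setP f0.
      by apply/permP => h; have := f0 h; rewrite !inE perm1 => /negbFE/eqP.
    have moved1 : moved (1%g : {perm H}) = set0.
      by apply/setP => h; rewrite !inE perm1 eqxx.
    rewrite /gluing moved1 sub0set cards0 andbT; split=> //.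
      by apply/forallP => h; rewrite !perm1.
    apply/forallP => P; apply/implyP => _; rewrite eqW sub1set.
    by case: (boolP (w \in P)) => //= wP; rewrite disjoints1.
  have vw : fibre_size S c w = #|S|.
    apply: eq_card => h; rewrite inE; case Sh: (h \in S) => //=.
    by have := SW h Sh; rewrite eqW inE.
  have := v2 w; rewrite eqW inE eqxx vw => /(_ isT) S_gt1.
  rewrite -eqW trees1 cards1 mul1r eqW big_set1 vw.
  rewrite (_ : #|S| + 2 - 2 * 1 = #|S|)%N; last by lia.
  by case: #|S| S_gt1 => // s _; rewrite subn1 factS natrM.
set v := fibre_size S c in v2 *.
have sumv : (\sum_(w in W) v w = #|S|)%N.
  rewrite /v /fibre_size -sum1_card (partition_big c (mem W)) //=.
  by apply: eq_bigr => w _; rewrite -sum1_card; apply: eq_bigl => h; rewrite inE.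
have S_ge : (2 * k.+2 <= #|S|)%N.
  by rewrite -sumv -DW mulnC -sum_nat_const; apply: leq_sum => w; apply: v2.
set P := \prod_(w in W) _.
set q := (#|S| + 2 - 2 * k.+2)`!%:R.
have recur : (\sum_(f in tree_gluings S W c) #|moved f|)%:R * q
  = \sum_(i in W) \sum_(j in W | i != j)
      ((v i)%:R + (v j)%:R - 2) * P * (#|S| - k.+3)`!%:R.
  rewrite (sum_card_moved SW) natr_sum mulr_suml.
  (* Summing over half-edges instead of vertices counts the pair (i, j) v_i v_j
     times: the two missing factors of the product for the contracted graph. *)
  pose G i j : rat := ((v i)%:R + (v j)%:R - 2) * P * (#|S| - k.+3)`!%:R.
  pose F i := \sum_(j in W | i != j) (v i)%:R^-1 * G i j.
  transitivity (\sum_(a in S) F (c a)); last first.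
    rewrite (sum_fibres _ SW); apply: eq_bigr => i Wi; rewrite mulr_sumr.
    apply: eq_bigr => j _; rewrite mulrA mulfV ?mul1r // pnatr_eq0.
    by have := v2 i Wi; rewrite /v; lia.
  apply: eq_bigr => a Sa; rewrite natr_sum mulr_suml.
  pose F' j := if c a != j then (v j)%:R^-1 * ((v (c a))%:R^-1 * G (c a) j) else 0.
  transitivity (\sum_(b in S) F' (c b)); last first.
    rewrite (sum_fibres _ SW) /F [RHS]big_mkcondr; apply: eq_bigr => j Wj /=.
    rewrite /F'; case: ifP => _; last by rewrite mulr0.
    rewrite -/(v j) [LHS]mulrA mulfV ?mul1r // pnatr_eq0.
    by have := v2 j Wj; rewrite /v; lia.
  rewrite [LHS]big_mkcondr; apply: eq_bigr => b Sb /=; rewrite /F'; case: ifP => // cab.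
  have cardW' : #|W :\ c b| = k.+1 by have := cardsD1 (c b) W; rewrite SW // DW => -[].
  have cardS' : (#|S :\ a :\ b|.+2 = #|S|)%N.
    have := cardsD1 a S; have := cardsD1 b (S :\ a); rewrite !inE Sa Sb.
    have -> : b != a by apply: contraNneq cab => ->.
    by rewrite /=; lia.
  have v2' : {in W :\ c b, forall w,
    (1 < fibre_size (S :\ a :\ b) (merge_vtx c (c a) (c b)) w)%N}.
    move=> w; rewrite !inE => /andP[wb Ww]; rewrite fibre_size_merge //.
    case: eqP => _; last exact: v2.
    by have := v2 _ (SW _ Sa); have := v2 _ (SW _ Sb); rewrite /v; lia.
  have := IHk _ _ _ cardW' (merge_sub SW Sa cab) v2'.
  have -> : (#|S :\ a :\ b| + 2 - 2 * k.+1 = #|S| + 2 - 2 * k.+2)%N by lia.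
  have -> : (#|S :\ a :\ b| - k.+1 = #|S| - k.+3)%N by lia.
  rewrite -/q => ->; rewrite /G /P mulrA mulrA; congr (_ * _).
  have Wa' : c a \in W :\ c b by rewrite !inE cab SW.
  rewrite (big_setD1 (c a) Wa') /= (big_setD1 (c b) (SW _ Sb)) /= (big_setD1 (c a) Wa') /=.
  rewrite fibre_size_merge // eqxx -/v.
  rewrite (eq_bigr (fun i => (v i)%:R)); last first.
    by move=> w; rewrite !inE => /and3P[/negPf wa wb _]; rewrite fibre_size_merge // wa.
  have va := v2 _ (SW _ Sa); have vb := v2 _ (SW _ Sb).
  rewrite natrB ?natrD; last by move: va vb; rewrite /v; lia.
  have ? : (v (c a))%:R != 0 :> rat by rewrite pnatr_eq0; lia.
  have ? : (v (c b))%:R != 0 :> rat by rewrite pnatr_eq0; lia.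
  by field; apply/andP.
have moved_const : (\sum_(f in tree_gluings S W c) #|moved f|
    = #|tree_gluings S W c| * (2 * k.+1))%N.
  rewrite -sum_nat_const; apply: eq_bigr => f.
  by rewrite inE DW => /and3P[_ _ /eqP]; lia.
move: recur; rewrite moved_const.
rewrite (eq_bigr (fun i => (\sum_(j in W | i != j) ((v i)%:R + (v j)%:R - 2))
    * (P * (#|S| - k.+3)`!%:R))); last first.
  by move=> i _; rewrite mulr_suml; apply: eq_bigr => j _; rewrite mulrA.
rewrite -mulr_suml sum_merged_fibres DW -natr_sum sumv.
have -> : (#|S| - k.+2)%N = (#|S| - k.+3).+1 by lia.
rewrite factS !natrM.
have -> : ((#|S| - k.+3).+1)%:R = #|S|%:R - k.+2%:R :> rat.
  by rewrite -natrB; last lia; congr _%:R; lia.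
move=> recur; have nz : 2 * k.+1%:R != 0 :> rat by rewrite mulf_neq0 ?pnatr_eq0.
apply: (mulfI nz); move: recur; rewrite -[k.+2]add1n natrD [1%:R + _]addrC addrK.
by rewrite !mulrA => recur; nra.
Qed.

(** * Stable graphs of genus 0 as labelled trees *)

Lemma isomorphic_refl G : isomorphic G G.
Proof.
exists id, id; split; try exact: (Bijective (g := id)).
by apply/and3P; split; apply/forallP.
Qed.

Lemma isomorphic_sym G G' : isomorphic G G' -> isomorphic G' G.
Proof.
case=> s [t [[s' sK s'K] [t' tK t'K] /and3P[/forallP hv /forallP hm /forallP hg]]].
exists s', t'; split; [by exists s | by exists t |].
apply/and3P; split; apply/forallP => x; apply/eqP.
- by apply: (can_inj sK); rewrite -(eqP (hv _)) t'K s'K.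
- by apply: (can_inj tK); rewrite -(eqP (hm _)) !t'K.
by rewrite -(eqP (hg _)) s'K.
Qed.

Lemma isomorphic_trans G1 G2 G3 :
  isomorphic G1 G2 -> isomorphic G2 G3 -> isomorphic G1 G3.
Proof.
case=> s [t [bs bt /and3P[/forallP hv /forallP hm /forallP hg]]].
case=> s' [t' [bs' bt' /and3P[/forallP hv' /forallP hm' /forallP hg']]].
exists (s' \o s), (t' \o t); split; [exact: bij_comp | exact: bij_comp |].
apply/and3P; split; apply/forallP => x /=.
- by rewrite (eqP (hv' _)) (eqP (hv _)).
- by rewrite (eqP (hm' _)) (eqP (hm _)).
by rewrite (eqP (hg' _)) (eqP (hg _)).
Qed.

Lemma isomorphic_class G G' : (isomorphic G = isomorphic G') <-> isomorphic G G'.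
Proof.
split=> [-> | GG']; first exact: isomorphic_refl.
apply/funext => G''; apply/propext; split; last exact: isomorphic_trans.
exact: isomorphic_trans (isomorphic_sym GG').
Qed.

Section Labelled.
Variables v h : nat.

Definition labelled : Type := ({ffun 'I_h -> 'I_v} * {perm 'I_h})%type.
HB.instance Definition _ := Finite.on labelled.
Implicit Type l : labelled.

(** The default value makes this an involution for every permutation, so that
    [tree_graph] is total. *)
Definition mate_of (f : {perm 'I_h}) : 'I_h -> 'I_h :=
  if [forall x, f (f x) == x] then fun x => f x else id.

Lemma mate_ofK f : involutive (mate_of f).
Proof. by rewrite /mate_of; case: ifP => // /forallP invf x; apply/eqP. Qed.

Definition tree_graph l : graph :=
  @Graph v h l.1 (mate_of l.2) (fun=> 0%N) (@mate_ofK l.2).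

Definition stable_tree l : bool :=
  (l.2 \in tree_gluings [set: 'I_h] [set: 'I_v] l.1)
  && [forall w, 2 < fibre_size [set: 'I_h] l.1 w]%N.

Lemma stable_treeP l : stable_tree l ->
  [/\ mate_of l.2 =1 l.2, edge_connected [set: 'I_v] l.1 l.2,
      (#|moved l.2| + 2 = 2 * v)%N & forall w, (2 < fibre_size [set: 'I_h] l.1 w)%N].
Proof.
case/andP; rewrite inE => /and3P[/andP[invl _] cl /eqP cardl] /forallP v3.
by split; rewrite // ?cardl ?cardsT ?card_ord // /mate_of invl.
Qed.

Definition relabel l (p : {perm 'I_v} * {perm 'I_h}) : labelled :=
  ([ffun x => p.1 (l.1 (p.2^-1%g x))], (l.2 ^ p.2)%g).

Fact relabel1 l : relabel l 1%g = l.
Proof.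
case: l => c f; rewrite /relabel /= conjg1; congr pair.
by apply/ffunP => x; rewrite ffunE invg1 !perm1.
Qed.

Fact relabelM l : act_morph relabel l.
Proof.
move=> p q; rewrite /relabel /= conjgM; congr pair.
by apply/ffunP => x; rewrite !ffunE invMg !permM.
Qed.

Canonical relabel_action := TotalAction relabel1 relabelM.

Lemma tree_graph_isomorphic l l' : mate_of l.2 =1 l.2 -> mate_of l'.2 =1 l'.2 ->
  isomorphic (tree_graph l) (tree_graph l') <-> exists p, relabel l p = l'.
Proof.
case: l l' => [c f] [c' f'] /= invf invf'; split.
  case=> s [t [/bij_inj injs /bij_inj injt /and3P[/forallP hv /forallP hm _]]].
  exists (perm injs, perm injt); congr pair.
    apply/ffunP => x; rewrite ffunE /= permE -(eqP (hv _)) /=; congr (c' _).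
    by rewrite -{1}(permE injt) permKV.
  apply/permP => x; rewrite -[x](permKV (perm injt)) permJ /=.
  move: ((perm injt)^-1%g x) => y; rewrite !permE.
  by have /eqP := hm y; rewrite /= invf invf'.
move=> [[s t]]; rewrite /relabel /= => -[Ec Ef]; subst c' f'.
exists s, t; split.
- exact/injF_bij/perm_inj.
- exact/injF_bij/perm_inj.
apply/and3P; split; apply/forallP => x //=.
  by rewrite ffunE permK.
by rewrite invf invf' permJ.
Qed.

Lemma Aut_tree_graph l : mate_of l.2 =1 l.2 ->
  Aut_graph (tree_graph l) = 'C_[set: {perm 'I_v} * {perm 'I_h}][l | relabel_action]%g.
Proof.
case: l => c f /= invf; apply/setP => -[s t]; rewrite !inE /=.
rewrite finset.sub1set inE /preserves_structure /=.
apply/and3P/eqP => [[/forallP hv /forallP hm _]|].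
  congr pair.
    by apply/ffunP => x; rewrite ffunE -(eqP (hv _)) permKV.
  apply/permP => x; rewrite -[x](permKV t) permJ; move: (t^-1%g x) => y.
  by have /eqP := hm y; rewrite !invf.
case=> Ec Ef; split; apply/forallP => x //=.
  by rewrite -{1}Ec ffunE permK.
by rewrite !invf -{1}Ef permJ.
Qed.

Lemma fibre_size_relabel l p w :
  fibre_size [set: 'I_h] (relabel l p).1 (p.1 w) = fibre_size [set: 'I_h] l.1 w.
Proof.
rewrite /fibre_size -[in RHS](card_imset _ (@perm_inj _ p.2)); apply: eq_card => x.
rewrite -[x](permKV p.2); move: (p.2^-1%g x) => y; rewrite mem_imset; last exact: perm_inj.
  by rewrite !inE ffunE permK (inj_eq perm_inj).
Qed.

Lemma stable_tree_relabel l p : stable_tree (relabel l p) = stable_tree l.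
Proof.
suff imp l' p' : stable_tree l' -> stable_tree (relabel l' p').
  apply/idP/idP; last exact: imp.
  by move/(imp _ p^-1%g); rewrite -relabelM mulgV relabel1.
case/andP; rewrite inE => /and3P[/andP[/forallP invl _] cl cardl] /forallP v3.
apply/andP; split; last first.
  by apply/forallP => w; rewrite -[w](permKV p'.1) fibre_size_relabel.
have actE x : (relabel l' p').2 (p'.2 x) = p'.2 (l'.2 x) by rewrite permJ.
have colE x : (relabel l' p').1 (p'.2 x) = p'.1 (l'.1 x) by rewrite ffunE permK.
rewrite inE; apply/and3P; split.
- rewrite /gluing subsetT andbT; apply/forallP => x.
  by rewrite -[x](permKV p'.2) !actE (eqP (invl _)).
- apply/forallP => P; apply/implyP => /forallP clP.
  have : edge_closed l'.1 l'.2 (p'.1 @^-1: P).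
    by apply/forallP => x; have := clP (p'.2 x); rewrite actE !colE !inE.
  move/(implyP (forallP cl _)) => /orP[sP|dP]; apply/orP; [left|right].
    apply/subsetP => w _.
    by have := subsetP sP (p'.1^-1%g w) (in_setT _); rewrite inE permKV.
  rewrite disjoint_subset; apply/subsetP => w _; rewrite inE.
  by have := disjointFr dP (in_setT (p'.1^-1%g w)); rewrite inE permKV => ->.
have -> : moved (relabel l' p').2 = p'.2 @: moved l'.2.
  apply/setP => x; rewrite -[x](permKV p'.2); move: (p'.2^-1%g x) => y.
  rewrite mem_imset; last exact: perm_inj.
  by rewrite !inE actE (inj_eq perm_inj).
by rewrite card_imset //; exact: perm_inj.
Qed.

Definition tree_weight l : rat := \prod_w chi_M 0 (fibre_size [set: 'I_h] l.1 w).

Lemma tree_weight_relabel l p : tree_weight (relabel l p) = tree_weight l.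
Proof.
rewrite /tree_weight (reindex_inj (@perm_inj _ p.1)).
by apply: eq_bigr => w _; rewrite fibre_size_relabel.
Qed.

(** Orbit-stabiliser: the automorphism group is the stabiliser of the labelled
    tree under relabelling, and the weight is constant on the orbit. *)
Lemma graph_weight_tree l : mate_of l.2 =1 l.2 ->
  graph_weight (tree_graph l)
  = \sum_(l' | l' \in orbit relabel_action [set: {perm 'I_v} * {perm 'I_h}]%g l)
      tree_weight l' / (v`! * h`!)%:R.
Proof.
move=> invl; rewrite (eq_bigr (fun=> tree_weight l / (v`! * h`!)%:R)); last first.
  by move=> l' /imsetP[p _ ->]; rewrite tree_weight_relabel.
rewrite sumr_const /graph_weight Aut_tree_graph //.
have -> : \prod_w chi_M (vgenus (g := tree_graph l) w) (valence w) = tree_weight l.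
  by apply: eq_bigr => w _; congr (chi_M 0 _); apply: eq_card => x; rewrite !inE.
have := card_orbit_stab relabel_action [set: {perm 'I_v} * {perm 'I_h}]%G l.
rewrite cardsT card_prod !card_Sn => <-; rewrite -mulr_natl natrM.
have o0 : #|orbit relabel_action [set: {perm 'I_v} * {perm 'I_h}]%G l|%:R != 0 :> rat.
  by rewrite pnatr_eq0 -lt0n; apply/card_gt0P; exists l; exact: orbit_refl.
have s0 : #|'C_[set: {perm 'I_v} * {perm 'I_h}][l | relabel_action]%g|%:R != 0 :> rat.
  by rewrite pnatr_eq0 -lt0n cardG_gt0.
by field; apply/andP.
Qed.

End Labelled.

Lemma adjacent_sym G : symmetric (@adjacent G).
Proof.
suff imp v w : @adjacent G v w -> @adjacent G w v.
  by move=> v w; apply/idP/idP; exact: imp.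
case/existsP=> x /andP[/eqP<- /eqP<-]; apply/existsP; exists (mate x).
by rewrite mateK !eqxx.
Qed.

(** The vertex sets closed under adjacency are exactly the closed sets used in
    [edge_connected]; if there is a single class of vertices they are trivial,
    and conversely the class of one vertex is closed, hence everything. *)
Lemma nb_components1P v h (l : labelled v h) : mate_of l.2 =1 l.2 -> (0 < v)%N ->
  nb_components (tree_graph l) = 1%N <-> edge_connected [set: 'I_v] l.1 l.2.
Proof.
move=> invl v_gt0; set e := @adjacent (tree_graph l).
have e_sym : connect_sym e by apply: sym_connect_sym; apply: adjacent_sym.
have closedE (P : {set 'I_v}) : edge_closed l.1 l.2 P <-> closed e P.
  split=> [/forallP clP x y /existsP[k /andP[/eqP<- /eqP<-]] /= | clP].
    by rewrite invl; apply/eqP/clP.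
  apply/forallP => k; apply/eqP/clP/existsP; exists k.
  by rewrite /= invl !eqxx.
rewrite /nb_components -/e; split=> [n1 | cl].
  apply/forallP => P; apply/implyP => /closedE clP.
  have root_eq x y : connect e x y.
    rewrite -(root_connect e_sym); apply/eqP.
    have /card_le1_eqP : (#|[predI roots e & predT]| <= 1)%N by rewrite -n1.
    by apply; rewrite !inE /= ?andbT roots_root.
  have [-> | [x Px]] := set_0Vmem P; apply/orP; [right|left].
    by rewrite disjoint_subset; apply/subsetP => x; rewrite !inE.
  by apply/subsetP => y _; rewrite -(closed_connect clP (root_eq x y)).
pose x0 : 'I_v := Ordinal v_gt0.
have clx : edge_closed l.1 l.2 [set y | connect e x0 y].
  apply/closedE => y z eyz; rewrite !inE.
  by apply: (same_connect_r e_sym); apply: connect1.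
rewrite -(n_comp_connect e_sym x0); apply: eq_n_comp_r => y.
have /orP[sx|dx] := implyP (forallP cl _) clx.
  by have := subsetP sx y (in_setT _); rewrite !inE => ->.
by have := disjointFr dx (in_setT x0); rewrite inE connect0.
Qed.

Lemma card_internal_edges G :
  (2 * #|internal_edges G| = #|[pred x : 'I_(nh G) | mate x != x]|)%N.
Proof.
pose edge (x : 'I_(nh G)) := [set x; mate x].
rewrite -[RHS]sum1_card (partition_big edge (mem (internal_edges G))) /=; last first.
  by move=> x mx; apply: imset_f.
rewrite mulnC -sum_nat_const; apply: eq_bigr => E /imsetP[x mx ->].
rewrite inE in mx; rewrite -/(edge x).
transitivity #|edge x|; first by rewrite cards2 eq_sym mx.
rewrite -sum1_card; apply: eq_bigl => y; rewrite !inE.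
apply/orP/andP => [[/eqP->|/eqP->]|[_ /eqP/setP/(_ y)]].
- by rewrite mx eqxx.
- by rewrite (inj_eq (inv_inj (@mateK G))) mx /edge mateK setUC.
by rewrite !inE eqxx /= => /esym/orP.
Qed.

Lemma card_external G :
  (nb_external G + #|[pred x : 'I_(nh G) | mate x != x]| = nh G)%N.
Proof.
by rewrite -[in RHS](card_ord (nh G)) -(cardC [pred x : 'I_(nh G) | mate x == x]).
Qed.

Lemma mate_of_perm h (mt : 'I_h -> 'I_h) (mtK : involutive mt) :
  mate_of (perm (inv_inj mtK)) = mt.
Proof.
apply/funext => x; rewrite /mate_of; case: ifP => [_|/forallP[] y]; rewrite !permE //.
by rewrite mtK.
Qed.

Lemma tree_graphE v h (vt : 'I_h -> 'I_v) mt (mtK : involutive mt) :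
  tree_graph ([ffun x => vt x], perm (inv_inj mtK)) = Graph vt (fun=> 0%N) mtK.
Proof.
rewrite /tree_graph; move: (mate_ofK _) => /=; rewrite mate_of_perm.
have -> : [ffun x => vt x] = vt :> (_ -> _) by apply/funext => x; rewrite ffunE.
by move=> K; congr Graph; apply: Prop_irrelevance.
Qed.

Lemma moved_mate v h (l : labelled v h) : mate_of l.2 =1 l.2 ->
  #|moved l.2| = (2 * #|internal_edges (tree_graph l)|)%N.
Proof.
by move=> invl; rewrite card_internal_edges; apply: eq_card => x; rewrite !inE /= invl.
Qed.

Lemma stable_tree_connected n k (l : labelled k.+1 (n + 2 * k)) :
  stable_tree l -> connected_stable_graph 0 n (tree_graph l).
Proof.
case/stable_treeP=> invl cl cardl v3.
have nc : nb_components (tree_graph l) = 1%N by apply/nb_components1P.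
have moved_l := moved_mate invl.
have ext : (nb_external (tree_graph l) + 2 * #|internal_edges (tree_graph l)|
    = n + 2 * k)%N.
  by rewrite card_internal_edges; apply: card_external.
rewrite moved_l in cardl; split=> //.
- apply/forallP => w; rewrite /= muln0 add0n.
  by have := v3 w; congr (_ < _)%N; apply: eq_card => x; rewrite !inE.
- rewrite /genus /betti1 nc [nv _]/= big1 //; lia.
by lia.
Qed.

(** Genus 0 reads (E - V + 1) + \sum_v g_v = 0 with both summands nonnegative, so
    both vanish; and n + 2k >= 3(k + 1) by stability. *)
Lemma connected_stable_tree n G : connected_stable_graph 0 n G ->
  exists k, (k < n - 2)%N /\
    exists l : labelled k.+1 (n + 2 * k), stable_tree l /\ tree_graph l = G.
Proof.
case: G => v h vt mt g mtK [].
set G := Graph _ _ _ => nc st g0 ext.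
pose l : labelled v h := ([ffun x => vt x], perm (inv_inj mtK)).
have lG : tree_graph l = Graph vt (fun=> 0%N) mtK := tree_graphE vt mtK.
have invl : mate_of l.2 =1 l.2.
  by move=> x; rewrite mate_of_perm permE.
have v_gt0 : (0 < v)%N.
  rewrite lt0n; apply/eqP => v0; have : (nb_components G <= v)%N.
    by rewrite -[X in (_ <= X)%N]card_ord max_card.
  by rewrite nc v0.
have nc' : nb_components (tree_graph l) = 1%N by rewrite lG.
have cl := (nb_components1P invl v_gt0).1 nc'.
have edges : #|moved l.2| = (2 * #|internal_edges G|)%N by rewrite moved_mate // lG.
have glT : gluing [set: 'I_h] l.2.
  by rewrite /gluing subsetT andbT; apply/forallP => x; rewrite !permE mtK.
have := edge_connected_bound glT (fun x _ => in_setT (l.1 x)) cl.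
rewrite edges cardsT card_ord => bound.
have ext' : (n + 2 * #|internal_edges G|)%N = h.
  by rewrite card_internal_edges -ext; apply: card_external.
move: g0; rewrite /genus /betti1 nc [nv _]/= => g0.
have sum_g : (\sum_(w < v) g w = 0)%N.
  move: g0 bound; set E := #|_|; set s := (\sum_(w < v) g w)%N. lia.
have eg : g = (fun=> 0%N).
  apply/funext => w; apply/eqP; move/eqP: sum_g; rewrite sum_nat_eq0.
  by move/forallP/(_ w).
have v3 : (3 * v <= h)%N.
  have -> : h = (\sum_(w < v) #|[pred x | vt x == w]|)%N.
    rewrite -[LHS]card_ord -sum1_card (partition_big vt xpredT) //=.
    by apply: eq_bigr => w _; rewrite -sum1_card; apply: eq_bigl => x; rewrite inE.
  rewrite mulnC -[v in (v * _)%N]card_ord -sum_nat_const; apply: leq_sum => w _.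
  by have /forallP/(_ w) := st; rewrite /G /= eg.
have [k [ev eh]] : exists k, v = k.+1 /\ h = (n + 2 * k)%N.
  exists v.-1; lia.
have tree : (l.2 \in tree_gluings [set: 'I_h] [set: 'I_v] l.1).
  by rewrite inE glT cl /= cardsT card_ord edges; apply/eqP; lia.
exists k; split; first lia.
have stl : stable_tree l.
  rewrite /stable_tree tree; apply/forallP => w.
  have /forallP/(_ w) := st; rewrite /G /= eg muln0 add0n.
  by congr (_ < _)%N; apply: eq_card => x; rewrite !inE /= ffunE.
have main : exists l' : labelled v h, stable_tree l' /\ tree_graph l' = G.
  by exists l; rewrite lG /G eg.
by move: main; rewrite ev eh.
Qed.

Lemma isomorphic_tree_graph v h (l : labelled v h) (G : graph) :
  stable_tree l -> isomorphic (tree_graph l) G ->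
  exists l' : labelled v h, stable_tree l' /\ tree_graph l' = G.
Proof.
move=> stl isoG; case: (isoG) => s [t [bs bt /and3P[_ _ /forallP hg]]].
have := bij_eq_card bs; have := bij_eq_card bt; rewrite !card_ord.
case: G => v' h' vt mt g mtK in s t isoG bs bt hg * => /= eh ev; subst v' h'.
have eg : g = (fun=> 0%N).
  apply/funext => w; case: bs => s' _ s'K.
  by have /eqP := hg (s' w); rewrite s'K.
subst g; rewrite -tree_graphE in isoG *; set l' := (_, _) in isoG *.
exists l'; split=> //.
have [invl _ _ _] := stable_treeP stl.
have invl' : mate_of l'.2 =1 l'.2 by move=> x; rewrite mate_of_perm permE.
by have [p <-] := (tree_graph_isomorphic invl invl').1 isoG; rewrite stable_tree_relabel.
Qed.

(** The representative of a class is itself the graph of a labelled tree, whose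
    orbit consists of all the labelled trees of that class. *)
Lemma graph_weight_class n k (l0 : labelled k.+1 (n + 2 * k)) (C : set graph) :
  stable_tree l0 -> C = isomorphic (tree_graph l0) ->
  graph_weight (xget empty_graph C)
  = \sum_(l : labelled k.+1 (n + 2 * k) |
        stable_tree l && (C == isomorphic (tree_graph l)))
      tree_weight l / (k.+1`! * (n + 2 * k)`!)%:R.
Proof.
move=> st0 eqC; set G := xget _ _.
have isoG : isomorphic (tree_graph l0) G.
  rewrite -eqC; apply: (@xgetPex _ empty_graph C); exists (tree_graph l0).
  by rewrite eqC; apply: isomorphic_refl.
have [inv0 _ _ _] := stable_treeP st0.
have [l1 [st1 eqG]] := isomorphic_tree_graph st0 isoG.
have [inv1 _ _ _] := stable_treeP st1.
rewrite -eqG graph_weight_tree //; apply: eq_bigl => l.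
apply/idP/andP => [/imsetP[p _ eql] | [stl /eqP eqCl]].
  have stl : stable_tree l by rewrite eql stable_tree_relabel.
  have [invl _ _ _] := stable_treeP stl.
  split=> //; rewrite eqC; apply/eqP/isomorphic_class.
  rewrite -eqG in isoG; apply: isomorphic_trans isoG _.
  by apply/tree_graph_isomorphic => //; exists p.
have [invl _ _ _] := stable_treeP stl.
have : isomorphic (tree_graph l1) (tree_graph l).
  rewrite eqG; apply: isomorphic_trans (isomorphic_sym isoG) _.
  by apply/isomorphic_class; rewrite -eqC.
case/tree_graph_isomorphic => // p eql; apply/imsetP; exists p; rewrite ?inE //.
Qed.

(** Each stable labelled tree belongs to exactly one class, so the sums over
    classes and over labelled trees can be exchanged. *)
Lemma sum_graph_classes n :
  \sum_(C \in stable_graph_classes 0 n) graph_weight (xget empty_graph C)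
  = \sum_(k < n - 2) \sum_(l : labelled k.+1 (n + 2 * k) | stable_tree l)
      tree_weight l / (k.+1`! * (n + 2 * k)`!)%:R.
Proof.
have classP C : stable_graph_classes 0 n C <->
    exists (k : 'I_(n - 2)) (l : labelled k.+1 (n + 2 * k)),
    stable_tree l /\ C = isomorphic (tree_graph l).
  split=> [[G /connected_stable_tree[k [lt_k [l [stl <-]]]] <-] | [k [l [stl ->]]]].
    by exists (Ordinal lt_k), l.
  by exists (tree_graph l) => //; apply: stable_tree_connected.
have fin : finite_set (stable_graph_classes 0 n).
  pose s := [seq isomorphic (@tree_graph k.+1 (n + 2 * k) l) |
     k <- iota 0 (n - 2), l <- enum {: labelled k.+1 (n + 2 * k)}].
  apply: (@sub_finite_set _ _ [set` s]%classic); last exact: finite_seq.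
  move=> C /classP[k [l [_ ->]]] /=; apply/allpairsPdep.
  by exists (k : nat), l; rewrite mem_iota mem_enum /=.
rewrite fsbig_finite //; set r := fset_set _.
have rP C : reflect (stable_graph_classes 0 n C) (C \in r).
  by rewrite /r in_fset_set //; apply: (iffP idP); rewrite in_setE.
transitivity (\sum_(C <- r) \sum_(k < n - 2)
    \sum_(l : labelled k.+1 (n + 2 * k) | stable_tree l)
      if C == isomorphic (tree_graph l)
      then tree_weight l / (k.+1`! * (n + 2 * k)`!)%:R else 0).
  rewrite big_seq [RHS]big_seq; apply: eq_bigr => C /rP/classP[k [l0 [st0 eqC]]].
  rewrite (graph_weight_class st0 eqC) big_mkcondr (bigD1 k) //=.
  rewrite [X in _ + X]big1 ?addr0 // => k' ne_k.
  (* Isomorphic graphs have as many vertices, so k is determined by the class. *)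
  apply: big1 => l stl; case: eqP => // eqC'.
  have : isomorphic (tree_graph l0) (tree_graph l) by apply/isomorphic_class; rewrite -eqC.
  case=> s [t [bs _ _]]; have := bij_eq_card bs; rewrite !card_ord /= => -[ek].
  by case/eqP: ne_k; apply: val_inj.
rewrite exchange_big; apply: eq_bigr => k _; rewrite exchange_big.
apply: eq_bigr => l stl /=; rewrite -big_mkcond /=.
have memr : isomorphic (tree_graph l) \in r by apply/rP/classP; exists k, l.
rewrite (big_rem _ memr) /= eqxx big_seq_cond big1 ?addr0 // => C.
by rewrite mem_rem_uniq ?fset_uniq // inE => /andP[/andP[/negPf-> _]].
Qed.

(** * Summation over labelled trees *)

Lemma bernoulli0 : bernoulli 0 = 1.
Proof.
rewrite /bernoulli mul1r; set f := Fps _.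
have Uf : f \is a GRing.unit by change (fps_coef f 0 != 0).
have /fpsP/(_ 0%N) := mulVr Uf.
by rewrite coef_fpsM big_ord1 /= invr1 mulr1.
Qed.

Lemma chi_M0 d : chi_M 0 d = (-1) ^+ d.+1 * (d - 3)`!%:R.
Proof. by rewrite /chi_M bernoulli0 muln0 sub0r !mulr1 exprSr. Qed.

(** The factor d is the contribution of a vertex of valence d to the number of
    tree gluings; the value 0 for d <= 2 enforces stability. *)
Definition rooted_chi d : rat := if (2 < d)%N then d%:R * chi_M 0 d else 0.

Lemma egf_rooted_chi : egf rooted_chi = fpsX * vertex_deriv.
Proof.
apply/fpsP => -[|d]; rewrite coef_fpsXM; first by rewrite /= mul0r.
rewrite coef_vertex_deriv -[egf _ _]/(rooted_chi d.+1 / d.+1`!%:R) /rooted_chi.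
case: d => [|[|d]] //=; rewrite ?mul0r // chi_M0.
rewrite !subSS subn0 !factS !natrM !exprS.
have ? : d`!%:R != 0 :> rat by rewrite pnatr_eq0 -lt0n fact_gt0.
have ? : d.+1%:R != 0 :> rat by rewrite pnatr_eq0.
have ? : d.+2%:R != 0 :> rat by rewrite pnatr_eq0.
have ? : d.+3%:R != 0 :> rat by rewrite pnatr_eq0.
by field; rewrite -!natrD nat1r; apply/and4P.
Qed.

Lemma coef_fps_sum (I : Type) (r : seq I) (P : pred I) (F : I -> fps rat) n :
  (\sum_(i <- r | P i) F i) n = \sum_(i <- r | P i) F i n.
Proof. exact: (big_morph (fun f : fps rat => f n)). Qed.

Lemma sum_stable_trees n k : (3 <= n)%N ->
  \sum_(l : labelled k.+1 (n + 2 * k) | stable_tree l)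
      tree_weight l / (k.+1`! * (n + 2 * k)`!)%:R = A k n.
Proof.
move=> n_ge3; set h := (n + 2 * k)%N.
have nzf m : m`!%:R != 0 :> rat by rewrite pnatr_eq0 -lt0n fact_gt0.
rewrite -mulr_suml coef_A; last by lia.
pose trees (c : {ffun 'I_h -> 'I_k.+1}) := tree_gluings [set: 'I_h] [set: 'I_k.+1] c.
transitivity ((\sum_(c : {ffun 'I_h -> 'I_k.+1}) \prod_w rooted_chi #|[pred x | c x == w]|)
   * ((n + k).-1`!%:R / n`!%:R) / (k.+1`! * h`!)%:R).
  congr (_ / _); rewrite mulr_suml big_mkcond /=.
  rewrite -(pair_bigA _
    (fun c f => if stable_tree (c, f) then tree_weight (c, f) else 0)) /=.
  apply: eq_bigr => c _.
  have fibreE w : fibre_size [set: 'I_h] c w = #|[pred x | c x == w]|.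
    by apply: eq_card => x; rewrite !inE.
  rewrite -big_mkcond /stable_tree /tree_weight /=.
  have [/forallP v3 | /forallPn[w v3]] :=
    boolP [forall w, 2 < fibre_size [set: 'I_h] c w]%N; last first.
    rewrite big_pred0 => [|f]; last by rewrite andbF.
    by rewrite (bigD1 w) //= /rooted_chi -fibreE (negPf v3) !mul0r.
  rewrite (eq_bigl (mem (trees c))) => [|f]; last by rewrite andbT.
  rewrite sumr_const -[LHS]mulr_natl.
  have cardT : (0 < #|[set: 'I_k.+1]|)%N by rewrite cardsT card_ord.
  have := card_tree_gluings cardT (fun x _ => in_setT (c x)) (fun w _ => ltnW (v3 w)).
  rewrite !cardsT !card_ord -/(trees c).
  rewrite (_ : h + 2 - 2 * k.+1 = n)%N; last by rewrite /h; lia.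
  rewrite (_ : h - k.+1 = (n + k).-1)%N; last by rewrite /h; lia.
  rewrite (eq_bigl xpredT) => [cardE|w]; last by rewrite inE.
  have -> : \prod_w rooted_chi #|[pred x | c x == w]|
      = \prod_w (fibre_size [set: 'I_h] c w)%:R
        * \prod_w chi_M 0 (fibre_size [set: 'I_h] c w).
    by rewrite -big_split; apply: eq_bigr => w _; rewrite /rooted_chi -fibreE v3.
  by apply: (mulIf (nzf n)); rewrite mulrAC cardE; field; rewrite nzf.
rewrite (egf_functions _ ord0) !card_ord egf_rooted_chi exprMn.
rewrite {2}(_ : h = (n + k).-1 + k.+1)%N ?coef_fpsXnM; last by rewrite /h; lia.
by rewrite natrM; field; rewrite !nzf.
Qed.

Theorem theorem5p1 (n : nat) (hn : (3 <= n)%N) :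
  chi_Mbar 0 n = n`!%:R * (\sum_(0 <= k < (n - 3).+1) A k) n.
Proof.
rewrite /chi_Mbar sum_graph_classes coef_fps_sum big_mkord.
have -> : (n - 3).+1 = (n - 2)%N by lia.
by congr (_ * _); apply: eq_bigr => k _; apply: sum_stable_trees.
Qed.
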